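(* Let $n\ge 1$ and let $K\in\mathbb{C}^{2n\times 2n}$ be a skew-symmetric matrix that is the kernel of a discrete Pfaffian point process $\mathcal{J}$ on the ground set $[n]=\{1,\dots,n\}$. Then the sequential sampling procedure described in the context, run with input $K$, is an exact sampler for $\mathcal{J}$: with probability one every step of the procedure is well defined (each parameter $p_j$ encountered is a real number in $[0,1]$ and each matrix that is inverted is invertible), and its random output $\mathcal{I}\subseteq[n]$ has the same distribution as $\mathcal{J}$, i.e. $\mathbb{P}(\mathcal{I}=S)=\mathbb{P}(\mathcal{J}=S)$ for every $S\subseteq[n]$.
   Context: The Pfaffian of a $2m\times 2m$ skew-symmetric matrix $A=-A^T$ is $$\mathrm{Pf}(A)=\frac{1}{2^m m!}\sum_{\sigma\in S_{2m}}\mathrm{sign}(\sigma)\prod_{i=1}^m A_{\sigma(2i-1),\sigma(2i)},$$ and the Pfaffian of the empty matrix is $1$. Block indexing: a $2n\times 2n$ matrix $K$ is viewed as an $n\times n$ matrix of $2\times 2$ blocks. For $X,Y\subseteq[n]$, $K_{X,Y}$ denotes the $2|X|\times 2|Y|$ submatrix of $K$ with rows $\{2x-1,2x : x\in X\}$ and columns $\{2y-1,2y : y\in Y\}$ (in increasing order), and $K_X=K_{X,X}$. The same notation is used for a matrix whose $2\times 2$ blocks are indexed by a subset of $[n]$. Let $J_1=\begin{pmatrix}0&1\\-1&0\end{pmatrix}$. Discrete Pfaffian point process: a random subset $\mathcal{J}$ of $[n]$ is a Pfaffian point process with kernel $K$ (a $2n\times 2n$ skew-symmetric matrix) if $\mathbb{P}(S\subseteq\mathcal{J})=\mathrm{Pf}(K_S)$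 for every $S\subseteq[n]$. Sampling procedure: set $\mathcal{I}=\emptyset$ and $K^{(1)}=K$. For $j=1,\dots,n$, given the current skew-symmetric matrix $K^{(j)}$ with $2\times 2$ blocks indexed by $\{j,\dots,n\}$, put $O=\{j\}$ and $O'=\{j+1,\dots,n\}$, and do the following. 1. Let $p_j=\mathrm{Pf}(K^{(j)}_{O})$, which is the upper right entry of the $2\times 2$ diagonal block of $K^{(j)}$ at index $j$. 2. Draw a Bernoulli random variable $b_j$ with success probability $p_j$, using fresh randomness that is independent of the randomness of the earlier steps. 3. If $b_j=1$, add $j$ to $\mathcal{I}$ and set $K^{(j+1)}=K^{(j)}_{O'}-K^{(j)}_{O',O}\,\bigl(K^{(j)}_{O}\bigr)^{-1}K^{(j)}_{O,O'}$. 4. If $b_j=0$, do not add $j$ and set $K^{(j+1)}=K^{(j)}_{O'}-K^{(j)}_{O',O}\,\bigl(K^{(j)}_{O}-J_1\bigr)^{-1}K^{(j)}_{O,O'}$. After step $j=n$ (where no update is needed), return $\mathcal{I}$. *)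

(* Defs.v *)
(* MathComp / MathComp-Analysis; complex numbers are R[i] with R : realType. *)
From HB Require Import structures.
From mathcomp Require Import all_boot all_order all_algebra all_fingroup.
From mathcomp Require Import all_classical all_reals all_analysis.
From mathcomp Require Import complex.
Set Implicit Arguments.
Unset Strict Implicit.
Unset Printing Implicit Defensive.
Import Order.TTheory GRing.Theory Num.Theory.
Local Open Scope ring_scope.
Local Open Scope complex_scope.

(* A matrix of n x n blocks of size 2 x 2 has type 'M_(n.*2).  With 0-based
   indices, block q occupies rows/columns 2q (r = false) and 2q+1 (r = true). *)
Lemma block_pos_subproof n (q : 'I_n) (r : bool) : (r + q.*2 < n.*2)%N.
Proof.
by case: r; rewrite ?add0n ?add1n ?ltn_Sdouble ?ltn_double ltn_ord.
Qed.

Definition block_pos n (q : 'I_n) (r : bool) : 'I_(n.*2) :=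
  Ordinal (block_pos_subproof q r).

Lemma half_ord_subproof n (i : 'I_(n.*2)) : (i./2 < n)%N.
Proof. by rewrite ltn_half_double ltn_ord. Qed.

Definition half_ord n (i : 'I_(n.*2)) : 'I_n := Ordinal (half_ord_subproof i).

Definition Pf (F : fieldType) m (A : 'M[F]_(m.*2)) : F :=
  (2 ^ m * m`!)%:R^-1 *
  \sum_(s : 'S_(m.*2)) (-1) ^+ s *
    \prod_(i < m) A (s (block_pos i false)) (s (block_pos i true)).

(* enum_val lists the elements of X in increasing order. *)
Definition block_emb n (X : {set 'I_n}) (i : 'I_(#|X|.*2)) : 'I_(n.*2) :=
  block_pos (enum_val (half_ord i)) (odd i).

Definition block_sub (F : fieldType) n (K : 'M[F]_(n.*2)) (X Y : {set 'I_n}) :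
    'M[F]_(#|X|.*2, #|Y|.*2) :=
  mxsub (@block_emb n X) (@block_emb n Y) K.

Definition J1 (F : fieldType) : 'M[F]_2 :=
  delta_mx ord0 ord_max - delta_mx ord_max ord0.

(* The measurability clause says that J is a random variable with values in the
   finite set of all subsets of 'I_n. *)
Definition pfaffian_process (R : realType) d (T : measurableType d)
    (P : probability T R) n (J : T -> {set 'I_n}) (K : 'M[R[i]]_(n.*2)) : Prop :=
  [/\ K^T = - K,
      forall S : {set 'I_n}, measurable [set t | J t = S]%classic &
      forall S : {set 'I_n},
        (fine (P [set t | S \subset J t]%classic))%:C = Pf (block_sub K S S)].

(* Source of fresh randomness: draw j p is the outcome of the Bernoulli draw of
   step j when it is requested with success probability p.  The parameter
   requested at step j depends on the earlier outcomes, but an event prescribing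
   the outcomes of all the steps involves a single parameter for each step, so
   independence is only required for each fixed choice of the parameters.
   If U_0, ..., U_(n-1) are independent and uniform on [0, 1], then
   draw j p = (U_j < p) is an example. *)
Definition fresh_bernoulli (R : realType) d (W : measurableType d)
    (Q : probability W R) n (draw : 'I_n -> R -> {RV Q >-> bool}) : Prop :=
  (forall (j : 'I_n) (p : R), 0 <= p <= 1 ->
     forall A : set bool, distribution Q (draw j p) A = bernoulli_prob p A) /\
  (forall p : 'I_n -> R, (forall j, 0 <= p j <= 1) ->
     forall A : 'I_n -> set bool,
       Q [set w | forall j, A j (draw j (p j) w)]%classic =
       (\prod_(j < n) Q (draw j (p j) @^-1` A j)%classic)%E).

(* Outcome of the procedure for given outcomes of the draws.  The current matrix,
   with m.+1 remaining blocks, is stored with its blocks renumbered from 0, so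
   that the block O of the current step is the leading 2 x 2 block (m.+1.*2 is
   convertible to 2 + m.*2) and the selected set is shifted back by lift ord0.
   The value None means that some step is not well defined.  In R[i] the
   condition 0 <= p <= 1 includes that p is real.  In the last step (m = 0) no
   update takes place: nothing has to be inverted, and the matrix passed on is
   empty. *)
Fixpoint pf_sampler (R : realType) m :
    'M[R[i]]_(m.*2) -> ('I_m -> R -> bool) -> option {set 'I_m} :=
  match m with
  | 0 => fun _ _ => Some finset.set0
  | m'.+1 => fun K draw =>
      let K' : 'M[R[i]]_(2 + m'.*2) := K in
      let KO : 'M[R[i]]_2 := ulsubmx K' in
      let p : R[i] := @Pf _ 1 KO in
      if 0 <= p <= 1 then
        let b := draw ord0 (complex.Re p) in
        let M := if b then KO else KO - J1 _ in
        if (m' == 0)%N || (M \in unitmx) then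
          let Knext := drsubmx K' - dlsubmx K' *m invmx M *m ursubmx K' in
          omap (fun I : {set 'I_m'} =>
                  (if b then finset.set1 ord0 else finset.set0)
                    :|: [set lift ord0 i | i in I]%SET)
               (pf_sampler Knext (fun i => draw (lift ord0 i)))
        else None
      else None
  end.

(* Main.v *)
Require Import Defs.
From HB Require Import structures.
From mathcomp Require Import all_boot all_order all_algebra all_fingroup.
From mathcomp Require Import all_classical all_reals all_analysis.
From mathcomp Require Import complex.
From mathcomp Require Import ring.
Set Implicit Arguments.
Unset Strict Implicit.
Unset Printing Implicit Defensive.
Import Order.TTheory GRing.Theory Num.Theory.
Local Open Scope ring_scope.
Local Open Scope complex_scope.

(** Write w(S) for the probability that the process equals S; inclusion
probabilities are the sums of w over supersets, and the kernel encodes them as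
Pfaffians of its principal block submatrices (the predicate [pf_law]). Working
with a mass function instead of a random variable allows pairing the kernel
obtained after each step with a law again.

The point of the proof is that one step of the procedure conditions w on the
status of the first index. Fix S among the remaining indices and consider the
principal submatrix on the first index and S.
- Its Pfaffian is the probability that the first index and S are included.
  Block elimination ([Pf_schur]) writes it as p times the Pfaffian on S of the
  Schur complement of the first block; hence that Schur complement is the kernel
  of w conditioned on including the first index.
- Subtracting J1 from the first diagonal block decreases the Pfaffian by the
  Pfaffian on S alone ([Pf_affine]), which leaves minus the probability that S
  is included and the first index is not. The modified block has Pfaffian p - 1,
  so eliminating it yields the kernel of w conditioned on excluding the first
  index.
This is [pf_law_next]. In particular each p met by the procedure is the
probability of an event, hence real and in [0, 1], and the block to invert
is singular only when the drawn outcome has probability zero.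

By induction ([pf_sampler_path]) each S determines the parameters requested
along the only sequence of outcomes that can return S, and the product of the
probabilities of these outcomes telescopes to w(S). Freshness of the draws turns
this product into the probability of returning S. Since the w(S) add up to 1, the
procedure almost surely does not fail. *)

(** * Pfaffians: congruence, affine dependence on the first block, elimination *)

Lemma half_block_pos n (q : 'I_n) r : half_ord (block_pos q r) = q.
Proof. by apply: val_inj; rewrite /= half_bit_double. Qed.

Lemma odd_block_pos n (q : 'I_n) r : odd (block_pos q r) = r.
Proof. by rewrite /= oddD odd_double addbF; case: r. Qed.

Lemma block_posK n (i : 'I_(n.*2)) : block_pos (half_ord i) (odd i) = i.
Proof. by apply: val_inj; rewrite /= odd_double_half. Qed.

Lemma block_pos_eq n (q q' : 'I_n) r r' :
  (block_pos q r == block_pos q' r') = (q == q') && (r == r').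
Proof.
apply/eqP/andP => [E|[/eqP-> /eqP->]//].
by rewrite -(half_block_pos q r) -{2}(odd_block_pos q r) E half_block_pos
  odd_block_pos.
Qed.

Lemma big_block (T : Type) (idx : T) (op : Monoid.com_law idx) n
    (f : 'I_(n.*2) -> T) :
  \big[op/idx]_i f i =
  \big[op/idx]_(q < n) op (f (block_pos q false)) (f (block_pos q true)).
Proof.
rewrite (reindex (fun x : 'I_n * bool => block_pos x.1 x.2)) /=; last first.
  exists (fun i => (half_ord i, odd i)) => [[q r] _|i _] /=.
    by rewrite half_block_pos odd_block_pos.
  exact: block_posK.
rewrite -(pair_bigA _ (fun q r => f (block_pos q r))) /=.
by apply: eq_bigr => q _; rewrite big_bool Monoid.mulmC.
Qed.

Section Congruence.
Variables (F : fieldType) (m : nat).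
Implicit Types A B : 'M[F]_(m.*2).

Definition pf_prod A (f : 'I_(m.*2) -> 'I_(m.*2)) : F :=
  \prod_(i < m) A (f (block_pos i false)) (f (block_pos i true)).

Lemma PfE A : Pf A = (2 ^ m * m`!)%:R^-1 *
  \sum_(s : 'S_(m.*2)) (-1) ^+ s * pf_prod A s.
Proof. by []. Qed.

(** Expanding both indices of all the factors gives one index of B for each of
the positions, that is, a single function g on all the positions. *)
Lemma pf_prod_congr A B (s : 'S_(m.*2)) :
  pf_prod (B *m A *m B^T) s =
  \sum_(g : {ffun 'I_(m.*2) -> 'I_(m.*2)})
    pf_prod A g * \prod_j B (s j) (g j).
Proof.
pose X i (k : 'I_(m.*2) * 'I_(m.*2)) := B (s (block_pos i false)) k.1 * A k.1 k.2 *
   B (s (block_pos i true)) k.2.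
transitivity (\prod_(i < m) \sum_k X i k).
  apply: eq_bigr => i _; rewrite mxE.
  under eq_bigr => l _ do rewrite !mxE big_distrl /=.
  by rewrite exchange_big pair_bigA.
rewrite bigA_distr_bigA /=.
pose h (g : {ffun 'I_(m.*2) -> 'I_(m.*2)}) :=
  [ffun i : 'I_m => (g (block_pos i false), g (block_pos i true))].
rewrite (reindex h) /=; last first.
  exists (fun f : {ffun 'I_m -> 'I_(m.*2) * 'I_(m.*2)} => [ffun j : 'I_(m.*2) =>
    if odd j then (f (half_ord j)).2 else (f (half_ord j)).1]) => [g _|f _].
    apply/ffunP => j; rewrite !ffunE /= -{4}(block_posK j).
    by case: (odd j).
  apply/ffunP => i; rewrite !ffunE !half_block_pos !odd_block_pos.
  by case: (f i).
apply: eq_bigr => g _; rewrite big_block -big_split /=.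
by apply: eq_bigr => i _; rewrite /X ffunE /= mulrAC mulrC.
Qed.

(** The signed sum over s of the B-factors attached to g is the determinant of
the rows of the transpose of B selected by g: it vanishes unless g is a
permutation t, and is then the sign of t times the determinant of B. *)
Lemma Pf_congr A B : Pf (B *m A *m B^T) = \det B * Pf A.
Proof.
rewrite !PfE mulrCA; congr (_ * _).
under eq_bigr => s _ do rewrite pf_prod_congr big_distrr /=.
rewrite exchange_big /= big_distrr /=.
pose N := m.*2.
have sum_det (g : {ffun 'I_N -> 'I_N}) :
    \sum_(s : 'S_N) (-1) ^+ s * (pf_prod A g * \prod_j B (s j) (g j)) =
    pf_prod A g * \det (rowsub g B^T).
  rewrite big_distrr /=; apply: eq_bigr => s _; rewrite mulrCA.
  by congr (_ * (_ * _)); apply: eq_bigr => j _; rewrite !mxE.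
under eq_bigr => g _ do rewrite sum_det.
rewrite (bigID (fun g : {ffun 'I_N -> 'I_N} => injectiveb g)) /= addrC.
rewrite big1 ?add0r => [|g /injectivePn[i1 [i2 Di12 Ef12]]]; last first.
  by rewrite (determinant_alternate Di12) ?mulr0 // => j; rewrite !mxE Ef12.
rewrite (reindex (@pval _)) /=; last first.
  pose in_Sn := insubd (1%g : 'S_N).
  by exists in_Sn => /= f Uf; first apply: val_inj; apply: insubdK.
apply: eq_big => /= [s | s _]; rewrite ?(valP s) //.
have -> : rowsub (pval s) B^T = row_perm s B^T.
  by apply/matrixP => i j; rewrite !mxE pvalE.
rewrite row_permE det_mulmx det_perm det_tr mulrA mulrC [_ * _ ^+ _]mulrC.
by congr (_ * (_ * _)); apply: eq_bigr => i _; rewrite !pvalE.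
Qed.

End Congruence.

Section Expansion.
Variables (F : numFieldType).

(** Exchanging the two positions of a pair is odd and negates one factor of a
skew matrix, so the signed term of s does not change. The block exchange in the
next lemma is even and merely permutes the factors. *)
Lemma pf_prod_swap m (A : 'M[F]_(m.*2)) (i : 'I_m) (s : 'S_(m.*2)) :
  A^T = - A ->
  pf_prod A (tperm (block_pos i false) (block_pos i true) * s)%g = - pf_prod A s.
Proof.
move=> Askew; rewrite /pf_prod (bigD1 i) //= [in RHS](bigD1 i) //=.
rewrite !permM tpermL tpermR -mulNr; congr (_ * _).
  by rewrite -[LHS]opprK -[RHS]opprK !opprK -[in LHS](opprK A) -Askew !mxE.
apply: eq_bigr => q qi.
by rewrite !permM !tpermD // block_pos_eq negb_and eq_sym qi.
Qed.

Lemma pf_prod_blockswap m (A : 'M[F]_(m.*2)) (i j : 'I_m) (s : 'S_(m.*2)) :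
  pf_prod A (tperm (block_pos i false) (block_pos j false) *
             tperm (block_pos i true) (block_pos j true) * s)%g = pf_prod A s.
Proof.
rewrite /pf_prod [RHS](reindex_perm (tperm i j)); apply: eq_bigr => q _.
have tp r r' (x y z : 'I_m) : tperm (block_pos x r) (block_pos y r)
    (block_pos z r') = block_pos (if r == r' then tperm x y z else z) r'.
  have [-> | rr'] := eqVneq r r'.
    case: (tpermP x y z) => [->|->|zx zy]; rewrite ?tpermL ?tpermR //.
    by rewrite tpermD // block_pos_eq eqxx andbT eq_sym; apply/eqP.
  by rewrite tpermD // block_pos_eq negb_and rr' orbT.
by rewrite !permM !tp.
Qed.

Definition ord00 m : 'I_(m.+1.*2) := block_pos ord0 false.
Definition ord01 m : 'I_(m.+1.*2) := block_pos ord0 true.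

Lemma ord00E m : ord00 m = (ord0 : 'I_(m.*2).+2).
Proof. exact: val_inj. Qed.

Lemma ord01E m : ord01 m = (lift ord0 ord0 : 'I_(m.*2).+2).
Proof. exact: val_inj. Qed.

(** Pair-preserving permutations of the positions move any of the 2(m+1)
positions to the first one without changing the signed term. Hence the
permutations that take the value 0 at a given position all contribute the same
amount, and it suffices to keep those with s 0 = 0. *)
Lemma Pf_first_row m (A : 'M[F]_(m.+1.*2)) : A^T = - A ->
  Pf A = (2 ^ m * m`!)%:R^-1 *
    \sum_(s : 'S_(m.+1.*2) | s (ord00 m) == ord00 m) (-1) ^+ s * pf_prod A s.
Proof.
move=> Askew.
pose S k := \sum_(s : 'S_(m.+1.*2) | s k == ord00 m) (-1) ^+ s * pf_prod A s.
have Sfalse i : S (block_pos i false) = S (ord00 m).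
  rewrite /S; set p := (tperm (block_pos ord0 false) (block_pos i false) *
             tperm (block_pos ord0 true) (block_pos i true))%g.
  rewrite (reindex_inj (mulgI p)) /=; apply: eq_big => [s|s _].
    by rewrite !permM tpermR tpermD // block_pos_eq andbF.
  rewrite pf_prod_blockswap !odd_permM !odd_tperm !block_pos_eq !andbT.
  by rewrite addbb.
have Strue i : S (block_pos i true) = S (block_pos i false).
  rewrite /S; set p := tperm (block_pos i false) (block_pos i true).
  rewrite (reindex_inj (mulgI p)) /=; apply: eq_big => [s|s _].
    by rewrite !permM tpermR.
  rewrite pf_prod_swap // odd_permM odd_tperm block_pos_eq andbF /=.
  by rewrite signrN mulrNN.
rewrite PfE (partition_big (fun s : 'S__ => (s^-1)%g (ord00 m)) predT) //=.
have -> : \sum_j \sum_(s : 'S_(m.+1.*2) | (s^-1)%g (ord00 m) == j)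
    (-1) ^+ s * pf_prod A s = \sum_j S j.
  apply: eq_bigr => k _; apply: eq_bigl => s.
  by rewrite (canF_eq (permKV s)) eq_sym.
rewrite big_block /= (eq_bigr (fun=> S (ord00 m) *+ 2)); last first.
  by move=> i _; rewrite Strue Sfalse mulr2n.
rewrite sumr_const card_ord -mulrnA -[_ *+ (2 * _)]mulr_natl mulrA.
congr (_ * _); rewrite expnS factS !natrM.
have f_neq0 : (m`!)%:R != 0 :> F by rewrite pnatr_eq0 -lt0n fact_gt0.
have x_neq0 : (2 ^ m)%:R != 0 :> F by rewrite pnatr_eq0 -lt0n expn_gt0.
have s_neq0 : m.+1%:R != 0 :> F by rewrite pnatr_eq0.
move: (m.+1%:R : F) ((m`!)%:R : F) ((2 ^ m)%:R : F) s_neq0 f_neq0 x_neq0 => a b c a0 b0 c0.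
by field; rewrite a0 b0 c0.
Qed.

Lemma lift_perm_inj n (i j : 'I_n.+1) : injective (lift_perm i j : 'S_n -> _).
Proof.
move=> s t st; apply/permP => k; apply: (@lift_inj _ j).
by rewrite -!(lift_perm_lift i) st.
Qed.

Lemma lift_perm_surj n (i : 'I_n.+1) (s : 'S_n.+1) :
  exists t : 'S_n, lift_perm i (s i) t = s.
Proof.
pose ulsf j (u : 'S_n.+1) k := odflt k (unlift (u j) (u (lift j k))).
have ulsfK j (u : 'S_n.+1) k : lift (u j) (ulsf j u k) = u (lift j k).
  rewrite /ulsf; have := neq_lift j k.
  by rewrite -(can_eq (permK u)) => /unlift_some[] ? ? ->.
have inj_ulsf : injective (ulsf i s).
  apply: can_inj (ulsf (s i) s^-1%g) _ => k'.
  by rewrite {1}/ulsf ulsfK !permK liftK.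
exists (perm inj_ulsf); apply/permP => k.
by case: (unliftP i k) => [k'|] ->; rewrite ?lift_perm_id // lift_perm_lift permE.
Qed.

(** The permutations that fix the first two positions are the double lifts of
the permutations of the others. *)
Lemma pf_prod_lift m (A : 'M[F]_(m.+1.*2)) (t : 'S_(m.*2)) :
  pf_prod A (lift_perm ord0 ord0 (lift_perm ord0 ord0 t)) =
  A (ord00 m) (ord01 m) * pf_prod (drsubmx (A : 'M[F]_(2 + m.*2))) t.
Proof.
have lift2 (f : bool) (i : 'I_m) :
    block_pos (lift ord0 i) f = lift ord0 (lift ord0 (block_pos i f)).
  by apply: val_inj; rewrite /= /bump /= !add1n doubleS !addnS.
rewrite /pf_prod big_ord_recl /=; congr (_ * _).
  congr (A _ _).
    by rewrite -[block_pos _ _]/(ord00 m) ord00E lift_perm_id.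
  by rewrite -[block_pos _ _]/(ord01 m) ord01E lift_perm_lift lift_perm_id.
apply: eq_bigr => i _; rewrite !lift2 !lift_perm_lift !mxE.
by congr (A _ _); apply: val_inj.
Qed.

(** The terms that pair 0 with 1 are isolated; they carry all the dependence on
the first diagonal block. *)
Lemma Pf_first_block m (A : 'M[F]_(m.+1.*2)) : A^T = - A ->
  Pf A = A (ord00 m) (ord01 m) * Pf (drsubmx (A : 'M[F]_(2 + m.*2))) +
    (2 ^ m * m`!)%:R^-1 * \sum_(s : 'S_(m.+1.*2) |
       (s (ord00 m) == ord00 m) && (s (ord01 m) != ord01 m))
       (-1) ^+ s * pf_prod A s.
Proof.
move=> Askew; rewrite Pf_first_row // PfE mulrCA -mulrDr; congr (_ * _).
rewrite (bigID (fun s : 'S_(m.+1.*2) => s (ord01 m) == ord01 m)) /=.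
congr (_ + _); rewrite big_distrr /=.
pose L (t : 'S_(m.*2)) : 'S_(m.+1.*2) :=
  lift_perm ord0 ord0 (lift_perm ord0 ord0 t).
have L0 t : L t (ord00 m) = ord00 m.
  by rewrite ord00E lift_perm_id.
have L1 t : L t (ord01 m) = ord01 m.
  by rewrite ord01E lift_perm_lift lift_perm_id.
have L_surj (s : 'S_(m.+1.*2)) : s (ord00 m) = ord00 m ->
    s (ord01 m) = ord01 m -> exists t, L t = s.
  move=> s0 s1; have [u us] := @lift_perm_surj (m.*2).+1 ord0 s.
  rewrite -ord00E s0 ord00E in us.
  have u0 : u ord0 = ord0.
    by apply: (@lift_inj _ ord0); rewrite -(lift_perm_lift ord0) us -ord01E s1 ord01E.
  have [t tu] := lift_perm_surj ord0 u.
  by exists t; rewrite /L -us -tu u0.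
pose g (s : 'S_(m.+1.*2)) : 'S_(m.*2) := odflt 1%g [pick t | L t == s].
have Lg (s : 'S_(m.+1.*2)) : s (ord00 m) = ord00 m -> s (ord01 m) = ord01 m -> L (g s) = s.
  move=> s0 s1; rewrite /g; case: pickP => [t /eqP //|no].
  by have [t ts] := L_surj s s0 s1; have := no t; rewrite ts eqxx.
rewrite (reindex L); last first.
  exists g => [t _|s /andP[/eqP s0 /eqP s1]]; last exact: Lg.
  by apply/(@lift_perm_inj _ ord0 ord0)/(@lift_perm_inj _ ord0 ord0)/Lg.
apply: eq_big => [t|t _]; first by rewrite L0 L1 !eqxx.
by rewrite pf_prod_lift mulrCA !odd_lift_perm.
Qed.

Lemma ord_first_block m (k : 'I_(m.+1.*2)) :
  (k < 2)%N -> k = ord00 m \/ k = ord01 m.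
Proof.
by case: k => -[|[|k]] // lt_k _; [left | right]; apply: val_inj.
Qed.

(** If s 0 = 0 and s 1 is not 1, no factor of the term of s has both of its
indices in the first block, so X and Y have the same remainder in
[Pf_first_block]. *)
Lemma Pf_affine m (X Y : 'M[F]_(m.+1.*2)) :
  X^T = - X -> Y^T = - Y ->
  (forall k l : 'I_(m.+1.*2), (1 < k)%N || (1 < l)%N -> X k l = Y k l) ->
  Pf X - Pf Y = (X (ord00 m) (ord01 m) - Y (ord00 m) (ord01 m)) *
    Pf (drsubmx (X : 'M[F]_(2 + m.*2))).
Proof.
move=> Xskew Yskew XY; rewrite !Pf_first_block //.
have -> : drsubmx (Y : 'M[F]_(2 + m.*2)) = drsubmx (X : 'M[F]_(2 + m.*2)).
  by apply/matrixP => k l; rewrite !mxE XY.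
rewrite [X in _ + X - _](_ : _ = (2 ^ m * m`!)%:R^-1 * \sum_(s : 'S_(m.+1.*2) |
       (s (ord00 m) == ord00 m) && (s (ord01 m) != ord01 m))
       (-1) ^+ s * pf_prod Y s); first by ring.
congr (_ * _); apply: eq_bigr => s /andP[/eqP s0 s1]; congr (_ * _).
apply: eq_bigr => i _; apply: XY; rewrite -[_ || _]negbK negb_or -!leqNgt.
have sneq : s (block_pos i true) != s (block_pos i false).
  by rewrite (inj_eq perm_inj) block_pos_eq andbF.
apply/negP => /andP[/ord_first_block E0 /ord_first_block E1].
case: E0 => E0; case: E1 => E1.
- by move: sneq; rewrite E0 E1 eqxx.
- have /perm_inj/eqP := etrans E0 (esym s0); rewrite block_pos_eq andbT.
  by move/eqP => i0; rewrite i0 in E1; case/eqP: s1.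
- by have /perm_inj/eqP := etrans E1 (esym s0); rewrite block_pos_eq andbF.
- by move: sneq; rewrite E0 E1 eqxx.
Qed.

(** Here the remainder in [Pf_first_block] vanishes: each of its terms contains
an entry of the first row outside the first block. *)
Lemma Pf_dsum m (X : 'M[F]_(m.+1.*2)) : X^T = - X ->
  (forall l : 'I_(m.+1.*2), (1 < l)%N -> X (ord00 m) l = 0) ->
  Pf X = X (ord00 m) (ord01 m) * Pf (drsubmx (X : 'M[F]_(2 + m.*2))).
Proof.
move=> Xskew X0; rewrite Pf_first_block // big1 ?mulr0 ?addr0 // => s.
case/andP=> /eqP s0 s1; rewrite /pf_prod (bigD1 ord0) //=.
rewrite -[block_pos ord0 false]/(ord00 m) s0 X0 ?mul0r ?mulr0 //.
rewrite ltnNge; apply/negP => /ord_first_block [E|E].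
  by have /perm_inj/eqP := etrans E (esym s0); rewrite block_pos_eq andbF.
by move: s1; rewrite E eqxx.
Qed.

Lemma invmx_skew n (M : 'M[F]_n) :
  M^T = - M -> M \in unitmx -> (invmx M)^T = - invmx M.
Proof.
move=> MT Munit; have NM : -1 *: M \in unitmx by rewrite unitmxZ // unitrN1.
by rewrite trmx_inv MT -scaleN1r invmxZ // invrN invr1 scaleN1r.
Qed.

(** Congruence by a unipotent lower block matrix, of determinant 1, makes the
matrix block diagonal with second block the Schur complement. *)
Lemma Pf_schur m (M : 'M[F]_2) (B : 'M[F]_(2, m.*2)) (C : 'M[F]_(m.*2, 2))
    (D : 'M[F]_(m.*2)) (X := block_mx M B C D) :
  X^T = - X -> M \in unitmx ->
  @Pf _ m.+1 X = M ord0 ord_max * Pf (D - C *m invmx M *m B).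
Proof.
rewrite /X {X} tr_block_mx opp_block_mx => /eq_block_mx[MT CT BT DT] Munit.
pose Z := D - C *m invmx M *m B.
pose L : 'M[F]_(2 + m.*2) := block_mx 1%:M 0 (- (C *m invmx M)) 1%:M.
have MiT := invmx_skew MT Munit.
have E : L *m block_mx M B C D *m L^T = block_mx M 0 0 Z.
  rewrite tr_block_mx !trmx1 trmx0 !mulmx_block !mul1mx !mul0mx !mulmx1 !mulmx0.
  rewrite !addr0 !mulNmx mulmxKV // addNr mul0mx add0r linearN /= trmx_mul MiT.
  by rewrite CT mulNmx opprK mulKVmx // addNr addrC.
have Xskew : (block_mx M 0 0 Z)^T = - block_mx M 0 0 Z.
  rewrite -E !trmx_mul trmxK tr_block_mx MT CT BT DT -opp_block_mx.
  by rewrite mulNmx mulmxN mulmxA.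
have detL : \det L = 1 by rewrite det_lblock !det1 mulr1.
rewrite -[LHS]mul1r -detL -[\det L * _](@Pf_congr F m.+1 _ L) E.
rewrite (@Pf_dsum m) //; last first.
  case=> -[|[|l]] // lt_l _.
  rewrite (_ : ord00 m = lshift _ (ord0 : 'I_2)); last exact: val_inj.
  have lt_l' : (l < m.*2)%N by [].
  rewrite (_ : Ordinal _ = rshift 2 (Ordinal lt_l')); last exact: val_inj.
  by apply: etrans (block_mxEur _ _ _ _ _ _) _; rewrite mxE.
congr (_ * _); last by rewrite block_mxKdr.
rewrite (_ : ord00 m = lshift _ (ord0 : 'I_2)); last exact: val_inj.
rewrite (_ : ord01 m = lshift _ (ord_max : 'I_2)); last exact: val_inj.
exact: block_mxEul.
Qed.

End Expansion.

(** * Principal block submatrices and the first index *)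

Definition block_cons m (b : bool) (S : {set 'I_m}) : {set 'I_m.+1} :=
  (if b then finset.set1 ord0 else finset.set0) :|: [set lift ord0 i | i in S]%SET.

Lemma in_block_cons0 m b (S : {set 'I_m}) : (ord0 \in block_cons b S) = b.
Proof.
rewrite inE; case: b; rewrite ?finset.set11 // finset.in_set0 /=.
by apply/imsetP => -[i _].
Qed.

Lemma in_block_cons_lift m b (S : {set 'I_m}) i : (lift ord0 i \in block_cons b S) = (i \in S).
Proof.
rewrite inE mem_imset ?orFb; last exact: lift_inj.
by case: b; rewrite ?finset.in_set1 ?finset.in_set0.
Qed.

Lemma block_cons_subset m b c (S T : {set 'I_m}) :
  (block_cons b S \subset block_cons c T) = (b ==> c) && (S \subset T).
Proof.
apply/fintype.subsetP/andP => [ST|[bc /fintype.subsetP ST] i].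
  split; first by apply/implyP => b1; rewrite -(in_block_cons0 c T) ST // in_block_cons0.
  by apply/fintype.subsetP => i iS; rewrite -(in_block_cons_lift c) ST // in_block_cons_lift.
by case: (unliftP ord0 i) => [j|] ->; rewrite ?in_block_cons0 ?in_block_cons_lift;
  [apply: ST | apply/implyP].
Qed.

Definition block_behead m (S : {set 'I_m.+1}) : {set 'I_m} := [set i | lift ord0 i \in S]%SET.

Lemma block_cons_behead m (S : {set 'I_m.+1}) : block_cons (ord0 \in S) (block_behead S) = S.
Proof.
apply/finset.setP => i; case: (unliftP ord0 i) => [j|] ->; rewrite ?in_block_cons0 //.
by rewrite in_block_cons_lift inE.
Qed.

Lemma block_consK m b (S : {set 'I_m}) : block_behead (block_cons b S) = S.
Proof. by apply/finset.setP => i; rewrite inE in_block_cons_lift. Qed.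

Lemma big_block_cons (V : nmodType) m (P : pred {set 'I_m.+1}) (f : {set 'I_m.+1} -> V) :
  \sum_(S | P S) f S = \sum_(S | P (block_cons true S)) f (block_cons true S) +
                       \sum_(S | P (block_cons false S)) f (block_cons false S).
Proof.
rewrite (bigID (fun S : {set 'I_m.+1} => ord0 \in S)) /=.
have half b : \sum_(S | P S && ((ord0 \in S) == b)) f S =
    \sum_(S | P (block_cons b S)) f (block_cons b S).
  rewrite (reindex (@block_cons m b)) /=; last first.
    exists (@block_behead m) => [S _|S]; first exact: block_consK.
    by rewrite inE => /andP[_ /eqP <-]; exact: block_cons_behead.
  by apply: eq_bigl => S; rewrite in_block_cons0 eqxx andbT.
by rewrite -(half true) -(half false); congr (_ + _); apply: eq_bigl => S;
  case: (ord0 \in S).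
Qed.

(** Block submatrices list their indices in increasing order, and the first
index comes before the shifted ones. *)
Lemma enum_block_cons m b (S : {set 'I_m}) :
  enum (block_cons b S) = (if b then [:: ord0] else [::]) ++ map (lift ord0) (enum S).
Proof.
have filt n (X : {set 'I_n}) : enum X = [seq x <- enum 'I_n | x \in X].
  by rewrite enumT /enum_mem; apply: eq_filter.
rewrite !filt enum_ordSl /= in_block_cons0 filter_map.
have -> : [seq x <- enum 'I_m | preim (lift ord0) [in block_cons b S] x] =
  [seq x <- enum 'I_m | x \in S].
  by apply: eq_filter => i /=; rewrite in_block_cons_lift.
by case: b.
Qed.

Lemma card_block_cons m b (S : {set 'I_m}) : #|block_cons b S| = (b + #|S|)%N.
Proof. by rewrite cardE enum_block_cons size_cat size_map -cardE; case: b. Qed.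

Section Submatrix.
Variable F : fieldType.

(** The size is constrained by an equation, here and in [Pf_2], because these
lemmas are applied with k the cardinality of the empty set, which is not
convertible to 0. *)
Lemma Pf_size0 k (A : 'M[F]_(k.*2)) : k = 0%N -> Pf A = 1.
Proof.
move=> k0; move: A; rewrite k0 => A.
rewrite PfE (big_pred1 1%g) /=; last first.
  by move=> s; symmetry; apply/eqP/permP => -[].
by rewrite odd_perm1 /pf_prod big_ord0 !mulr1 expn0 mul1n invr1.
Qed.

Lemma Pf_mxsub_eq n (K : 'M[F]_n) k1 k2 (f1 : 'I_(k1.*2) -> 'I_n)
    (f2 : 'I_(k2.*2) -> 'I_n) :
  k1 = k2 -> (forall (i : 'I_(k1.*2)) (j : 'I_(k2.*2)), i = j :> nat -> f1 i = f2 j) ->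
  Pf (mxsub f1 f1 K) = Pf (mxsub f2 f2 K).
Proof.
move=> k12; case: k2 / k12 in f2 * => f12.
by congr Pf; apply/matrixP => i j; rewrite !mxE !(f12 _ _ erefl).
Qed.

Variables (m : nat) (K : 'M[F]_(2 + m.*2)).

Lemma block_emb_block_cons b (S : {set 'I_m}) (i : 'I_(#|block_cons b S|.*2))
    (j : 'I_(#|S|.*2)) :
  i = (b.*2 + j)%N :> nat -> block_emb i = rshift 2 (block_emb j) :> 'I_(2 + _).
Proof.
move=> ij; apply: val_inj => /=.
have odd_ij : odd i = odd j by rewrite ij oddD odd_double.
have half_ij : i./2 = (b + j./2)%N by rewrite ij halfD odd_double doubleK.
have j_lt : (j./2 < size (enum S))%N by rewrite -cardE ltn_half_double.
rewrite odd_ij (enum_val_nth ord0) enum_block_cons /= half_ij nth_cat.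
have -> : (b + j./2 < size (if b then [:: ord0 : 'I_m.+1] else [::]))%N = false.
  by case: b {i ij odd_ij half_ij}; rewrite ltnNge ?leq_addr.
have -> : (b + j./2 - size (if b then [:: ord0 : 'I_m.+1] else [::]) = j./2)%N.
  by case: b {i ij odd_ij half_ij}; rewrite /= addKn.
have x0 : 'I_m by move: j_lt; case: (enum S).
rewrite (nth_map x0) // (enum_val_nth x0 (half_ord j)) /= /bump /= add1n.
by rewrite doubleS !addnS.
Qed.

Lemma Pf_block_cons_false (S : {set 'I_m}) :
  @Pf _ _ (@block_sub F m.+1 K (block_cons false S) (block_cons false S)) =
  Pf (block_sub (drsubmx K) S S).
Proof.
have -> : block_sub (drsubmx K) S S =
    mxsub (@rshift 2 _ \o @block_emb _ S) (@rshift 2 _ \o @block_emb _ S) K.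
  by apply/matrixP => i j; rewrite !mxE.
apply: Pf_mxsub_eq => [|i j ij]; first exact: card_block_cons.
exact: block_emb_block_cons.
Qed.

(** The submatrix of K on the first block and S, with the first diagonal block
replaced by M; having size 2 + 2#|S| by construction, it is suited to block
elimination, in contrast to the submatrix on the set [block_cons true S]. *)
Definition corner_sub (M : 'M[F]_2) (S : {set 'I_m}) : 'M[F]_(2 + #|S|.*2) :=
  block_mx M (colsub (@block_emb _ S) (ursubmx K))
    (rowsub (@block_emb _ S) (dlsubmx K)) (block_sub (drsubmx K) S S).

Lemma Pf_block_cons_true (S : {set 'I_m}) :
  @Pf _ _ (@block_sub F m.+1 K (block_cons true S) (block_cons true S)) =
  @Pf _ #|S|.+1 (corner_sub (ulsubmx K) S).
Proof.
pose g (k : 'I_(2 + #|S|.*2)) : 'I_(2 + m.*2) :=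
  match fintype.split k with inl a => lshift _ a | inr c => rshift 2 (block_emb c) end.
have -> : corner_sub (ulsubmx K) S = mxsub g g K.
  apply/matrixP => i j; rewrite !mxE /g.
  by case: (fintype.split i) => a; rewrite !mxE; case: (fintype.split j) => c; rewrite !mxE.
apply: (@Pf_mxsub_eq _ _ _ #|S|.+1) => [|i j ij]; first exact: card_block_cons.
rewrite /g; case: splitP => [a|c] ja; last first.
  by apply: block_emb_block_cons; rewrite ij ja.
have i2 : (i < 2)%N by rewrite ij ja.
apply: val_inj => /=; rewrite -ja -ij (enum_val_nth ord0) enum_block_cons /=.
by case: (i : nat) i2 => [|[|]].
Qed.

End Submatrix.

Lemma Pf_2 (F : numFieldType) k (A : 'M[F]_(k.+1.*2)) : k = 0%N -> A^T = - A ->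
  Pf A = A (ord00 k) (ord01 k).
Proof.
move=> k0 Askew; rewrite Pf_dsum // => [|l]; first by rewrite Pf_size0 // mulr1.
have l2 : (l < 2)%N by have := ltn_ord l; move: (l : nat) => i; rewrite k0.
by rewrite ltnNge -ltnS l2.
Qed.

(** * One step conditions the law on the first index *)

Lemma det_skew2 (F : numFieldType) (M : 'M[F]_2) : M^T = - M ->
  \det M = M ord0 ord_max ^+ 2.
Proof.
move=> Mskew.
have ME i j : M j i = - M i j.
  by move/matrixP/(_ i j): Mskew; rewrite !mxE.
have M0 i : M i i = 0.
  by apply/eqP; rewrite -[_ == _](mulrn_eq0 _ 2) mulr2n {1}ME addNr.
rewrite (expand_det_row _ ord0) !big_ord_recl big_ord0 M0 mul0r add0r addr0.
rewrite (_ : lift _ _ = ord_max); last exact: val_inj.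
rewrite /cofactor expr1 det_mx11 !mxE mulN1r.
rewrite (_ : lift _ _ = ord_max); last exact: val_inj.
rewrite (_ : lift _ _ = ord0); last exact: val_inj.
by rewrite (ME ord0 ord_max) opprK.
Qed.

Section Law.
Variable R : realType.

(** K is the kernel of a Pfaffian point process whose law has mass function w.
That the masses add up to 1 is the case of the empty S. *)
Definition pf_law m (w : {set 'I_m} -> R) (K : 'M[R[i]]_(m.*2)) : Prop :=
  [/\ K^T = - K, forall S, 0 <= w S &
      forall S : {set 'I_m}, (\sum_(T : {set 'I_m} | S \subset T) w T)%:C = Pf (block_sub K S S)].

Lemma pf_law_sum1 m w (K : 'M[R[i]]_(m.*2)) : pf_law w K -> \sum_T w T = 1.
Proof.
case=> _ _ /(_ finset.set0); rewrite (eq_bigl predT); last first.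
  by move=> T; rewrite finset.sub0set.
by rewrite Pf_size0 ?cards0 // => -[].
Qed.

Variables (m : nat) (w : {set 'I_m.+1} -> R) (K : 'M[R[i]]_(2 + m.*2)).
Hypothesis wK : @pf_law m.+1 w K.

(** The probability that the status of the first index is b. *)
Definition marg b := \sum_(S : {set 'I_m}) w (block_cons b S).
(** The block inverted by the procedure when the outcome is b. *)
Definition pivot (b : bool) : 'M[R[i]]_2 :=
  if b then ulsubmx K else ulsubmx K - J1 _.
Definition next_kernel b : 'M[R[i]]_(m.*2) :=
  drsubmx K - dlsubmx K *m invmx (pivot b) *m ursubmx K.

Lemma K_skew : K^T = - K. Proof. by case: wK. Qed.

Lemma K_skewE i j : K j i = - K i j.
Proof. by move/matrixP/(_ i j): K_skew; rewrite !mxE. Qed.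

Lemma ul_skew : (ulsubmx K)^T = - ulsubmx K.
Proof. by apply/matrixP => i j; rewrite !mxE K_skewE. Qed.

Lemma marg_ge0 b : 0 <= marg b.
Proof. by apply: sumr_ge0 => S _; case: wK. Qed.

Lemma marg_sum : marg true + marg false = 1.
Proof. by rewrite -(pf_law_sum1 wK) big_block_cons. Qed.

(** A superset of the shift of S may or may not contain the first index; a
superset of the first index and S must contain it. *)
Lemma pf_law_block_cons b (S : {set 'I_m}) : (\sum_(T : {set 'I_m} | S \subset T) w (block_cons true T) +
    (if b then 0 else \sum_(T : {set 'I_m} | S \subset T) w (block_cons false T)))%:C =
  Pf (@block_sub _ m.+1 K (block_cons b S) (block_cons b S)).
Proof.
case: wK => _ _ <-; congr _%:C; rewrite big_block_cons.
congr (_ + _); first by apply: eq_bigl => T; rewrite block_cons_subset implybT.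
case: b; last by apply: eq_bigl => T; rewrite block_cons_subset.
by rewrite big_pred0 // => T; rewrite block_cons_subset.
Qed.

Lemma corner_skew M (S : {set 'I_m}) : M^T = - M -> (corner_sub K M S)^T = - corner_sub K M S.
Proof.
move=> Mskew.
rewrite tr_block_mx opp_block_mx Mskew; congr block_mx.
- by apply/matrixP => i j; rewrite !mxE K_skewE.
- by apply/matrixP => i j; rewrite !mxE K_skewE.
- by apply/matrixP => i j; rewrite !mxE K_skewE.
Qed.

Lemma corner_sub01 M S : corner_sub K M S (ord00 _) (ord01 _) = M ord0 ord_max.
Proof.
rewrite (_ : ord00 _ = lshift _ (ord0 : 'I_2)); last exact: val_inj.
rewrite (_ : ord01 _ = lshift _ (ord_max : 'I_2)); last exact: val_inj.
exact: block_mxEul.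
Qed.

Lemma corner_sub_eq M N (S : {set 'I_m}) (k l : 'I_(2 + #|S|.*2)) :
  (1 < k)%N || (1 < l)%N -> corner_sub K M S k l = corner_sub K N S k l.
Proof.
case: (fintype.split_ordP k) => k' ->; case: (fintype.split_ordP l) => l' ->.
- by case/orP; rewrite /= ltnNge -ltnS ltn_ord.
- by rewrite !block_mxEur.
- by rewrite !block_mxEdl.
- by rewrite !block_mxEdr.
Qed.

(** The upper right entry is the Pfaffian of the principal submatrix on the first
index, hence the probability of including it. *)
Lemma ul01 : ulsubmx K ord0 ord_max = (marg true)%:C.
Proof.
transitivity (@Pf _ #|(finset.set0 : {set 'I_m})|.+1
                (corner_sub K (ulsubmx K) finset.set0)).
  rewrite Pf_2 ?cards0 ?corner_sub01 //; exact: (corner_skew _ ul_skew).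
rewrite -Pf_block_cons_true -pf_law_block_cons addr0; congr _%:C.
by apply: eq_bigl => T; rewrite finset.sub0set.
Qed.

Lemma Pf_ul : @Pf _ 1 (ulsubmx K) = (marg true)%:C.
Proof.
rewrite (@Pf_2 _ 0 _ erefl ul_skew) -ul01.
by congr (ulsubmx K _ _); apply: val_inj.
Qed.

Lemma J1_skew : (J1 R[i])^T = - J1 _.
Proof. by rewrite /J1 linearB /= !trmx_delta opprB. Qed.

Lemma pivot_skew b : (pivot b)^T = - pivot b.
Proof.
case: b; rewrite /pivot; first exact: ul_skew.
by rewrite linearB /= J1_skew ul_skew [RHS]opprD.
Qed.

Lemma pivot01 b : pivot b ord0 ord_max = (if b then marg true else - marg false)%:C.
Proof.
case: b; rewrite /pivot ?ul01 //.
have J01 : J1 R[i] ord0 ord_max = 1 by rewrite !mxE /= subr0.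
rewrite [LHS]mxE [X in _ + X]mxE ul01 J01 -[1]/((1 : R)%:C).
by rewrite -rmorphB /= -marg_sum; congr _%:C; ring.
Qed.

Lemma pivot_unit b : (pivot b \in unitmx) = (marg b != 0).
Proof.
rewrite unitmxE det_skew2 ?pivot_skew // pivot01 unitfE expf_eq0 /=.
by rewrite fmorph_eq0; case: b; rewrite ?oppr_eq0.
Qed.

(** The Pfaffian of the submatrix on the first index and S, with the pivot as its
first block, is computed twice. Elimination gives the pivot entry times the
left-hand side. On the other hand it is the joint inclusion probability if b
holds; otherwise the shift by J1 subtracts the inclusion probability of S, which
leaves minus the probability of including S but not the first index. When b
fails, the pivot entry is negative as well, and the signs cancel. *)
Lemma Pf_next_kernel b (S : {set 'I_m}) : marg b != 0 ->
  Pf (block_sub (next_kernel b) S S) =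
  ((\sum_(T : {set 'I_m} | S \subset T) w (block_cons b T)) / marg b)%:C.
Proof.
move=> b0.
have schur : (if b then marg true else - marg false)%:C *
    Pf (block_sub (next_kernel b) S S) = @Pf _ #|S|.+1 (corner_sub K (pivot b) S).
  have Munit : pivot b \in unitmx by rewrite pivot_unit.
  rewrite [RHS](Pf_schur (corner_skew S (pivot_skew b)) Munit) pivot01.
  congr (_ * Pf _); apply/matrixP => i j; rewrite !mxE; congr (_ - _).
  apply: eq_bigr => k _; rewrite !mxE; congr (_ * _).
  by apply: eq_bigr => l _; rewrite !mxE.
have Pf_pivot : @Pf _ #|S|.+1 (corner_sub K (pivot b) S) =
   (if b then \sum_(T : {set 'I_m} | S \subset T) w (block_cons true T)
    else - \sum_(T : {set 'I_m} | S \subset T) w (block_cons false T))%:C.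
  case: b {schur b0}.
    by rewrite -Pf_block_cons_true -pf_law_block_cons addr0.
  have := @Pf_affine _ #|S| (corner_sub K (pivot false) S)
    (corner_sub K (ulsubmx K) S) (corner_skew _ (pivot_skew false))
    (corner_skew _ ul_skew) (@corner_sub_eq _ _ S).
  rewrite !corner_sub01 pivot01 ul01 block_mxKdr -Pf_block_cons_true.
  rewrite -Pf_block_cons_false -!pf_law_block_cons addr0.
  rewrite -rmorphB /= (_ : - marg false - marg true = -1); last first.
    by rewrite -marg_sum; ring.
  move=> /eqP; rewrite subr_eq => /eqP ->.
  by rewrite -rmorphM -rmorphD /=; congr _%:C; ring.
move: schur; rewrite Pf_pivot => /esym E.
case: b b0 E {Pf_pivot} => b0 E.
  by rewrite fmorph_div /= E mulrAC mulfV ?mul1r // fmorph_eq0.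
apply: (@mulfI _ (- marg false)%:C); first by rewrite fmorph_eq0 oppr_eq0.
by rewrite -E -rmorphM /= mulNr mulrCA divff ?mulr1.
Qed.

Lemma pf_law_next b : marg b != 0 ->
  pf_law (fun S => w (block_cons b S) / marg b) (next_kernel b).
Proof.
move=> b0; split.
- have urE : dlsubmx K = - (ursubmx K)^T.
    by apply/matrixP => i j; rewrite !mxE K_skewE.
  rewrite /next_kernel urE !mulNmx opprK linearD /= !trmx_mul trmxK mulmxA.
  rewrite invmx_skew ?pivot_skew ?pivot_unit //.
  rewrite mulmxN mulNmx opprD; congr (_ - _).
  by apply/matrixP => i j; rewrite !mxE K_skewE.
- by move=> S; rewrite divr_ge0 ?marg_ge0 //; case: wK.
by move=> S; rewrite Pf_next_kernel // big_distrl.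
Qed.

End Law.

(** * The outcomes that return a given set *)

Section Path.
Variable R : realType.

Lemma pf_samplerS m (w : {set 'I_m.+1} -> R) (K : 'M[R[i]]_(2 + m.*2))
    (draw : 'I_m.+1 -> R -> bool) (b := draw ord0 (marg w true)) :
  @pf_law _ m.+1 w K ->
  @pf_sampler _ m.+1 K draw =
  if (m == 0)%N || (marg w b != 0) then
    omap (block_cons b) (pf_sampler (next_kernel K b) (fun i => draw (lift ord0 i)))
  else None.
Proof.
move=> wK; rewrite /= (Pf_ul wK).
have -> : 0 <= (marg w true)%:C <= 1.
  have := marg_ge0 wK false; have := marg_ge0 wK true.
  rewrite -[1]/((1 : R)%:C) !lecR -(marg_sum wK) => -> ?.
  by rewrite lerDl.
by rewrite -(pivot_unit wK).
Qed.

Definition fcons T m (a : T) (f : 'I_m -> T) (j : 'I_m.+1) : T :=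
  if unlift ord0 j is Some i then f i else a.

Lemma pf_sampler_size0 m (K : 'M[R[i]]_(m.*2)) draw S :
  m = 0%N -> pf_sampler K draw = Some S.
Proof.
move=> m0; move: K draw S; rewrite m0 => K draw S.
by congr Some; apply/finset.setP => -[].
Qed.

Lemma omap_block_cons m b (X : option {set 'I_m}) S :
  omap (block_cons b) X = Some S <-> b = (ord0 \in S) /\ X = Some (block_behead S).
Proof.
split=> [|[-> ->]]; last by rewrite /= block_cons_behead.
by case: X => //= Y [<-]; rewrite in_block_cons0 block_consK.
Qed.

(** The only outcomes that can return S are those that follow membership in S,
so the parameters p that they request are determined; ok says that no
singular block has to be inverted on this path. If the outcome prescribed for the first
index has probability 0, then w S = 0 and the parameters of the later steps do
not matter: when later steps exist, the pivot is singular and the procedure fails;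
otherwise nothing is inverted, S can be returned, and the product is 0 all
the same. *)
Lemma pf_sampler_path m (w : {set 'I_m} -> R) (K : 'M[R[i]]_(m.*2)) S :
  pf_law w K -> exists (p : 'I_m -> R) (ok : bool),
  [/\ forall j, 0 <= p j <= 1,
      forall draw, pf_sampler K draw = Some S <->
        ok /\ forall j, draw j (p j) = (j \in S) &
      w S = if ok then \prod_j (if j \in S then p j else 1 - p j) else 0].
Proof.
elim: m => [|m IHm] in w K S *; move=> wK.
  exists (fun=> 0), true; split=> [j|draw|]; first by rewrite lexx ler01.
    by split=> [_|_]; [split=> // -[]|apply: pf_sampler_size0].
  rewrite big_ord0 -(pf_law_sum1 wK) (big_pred1 S) // => T.
  by symmetry; apply/eqP/finset.setP => -[].
set b := ord0 \in S; set S' := block_behead S.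
have Scons : S = block_cons b S' by rewrite block_cons_behead.
have margP c : marg w c = if c then marg w true else 1 - marg w true.
  by case: c => //; rewrite -(marg_sum wK) addrC addKr.
have p01 : 0 <= marg w true <= 1.
  by rewrite (marg_ge0 wK) -subr_ge0 -(margP false) (marg_ge0 wK).
have [b0|b0] := eqVneq (marg w b) 0.
  exists (fun=> marg w true), (m == 0)%N; split=> // [draw|].
    rewrite (pf_samplerS _ wK); set c := draw ord0 _; case: eqP => /= [m0|m0].
      split=> [/omap_block_cons[cb _]|[_ dS]].
        split=> // j; rewrite (_ : j = ord0) //; apply: val_inj.
        by case: j => j /= lt_j; move: lt_j; rewrite m0; case: j.
      apply/omap_block_cons; split; first exact: dS.
      exact: pf_sampler_size0.
    split=> [|[]//]; case: ifP => // c0 /omap_block_cons[cb _].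
    by move: c0; rewrite cb -/b b0 eqxx.
  have -> : w S = 0.
    apply/eqP; rewrite eq_le; case: (wK) => _ -> _; rewrite andbT -b0 Scons.
    rewrite /marg (bigD1 S') //= lerDl; apply: sumr_ge0 => T _.
    by case: wK.
  by case: ifP => // _; rewrite big_ord_recl -/b -margP b0 mul0r.
have [p [ok [p_01 pathP prodP]]] := IHm _ _ S' (pf_law_next wK b0).
exists (fcons (marg w true) p), ok.
have fc0 : fcons (marg w true) p ord0 = marg w true by rewrite /fcons unlift_none.
have fcS j : fcons (marg w true) p (lift ord0 j) = p j by rewrite /fcons liftK.
split=> [j|draw|].
- by rewrite /fcons; case: unlift.
- rewrite (pf_samplerS _ wK); set c := draw ord0 _.
  split=> [|[okT dS]].
    case: ifP => // _ /omap_block_cons[cb]; rewrite cb => /pathP[-> dS].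
    split=> // j; case: (unliftP ord0 j) => [i|] ->; last by rewrite fc0.
    by rewrite fcS dS inE.
  have cb : c = b by rewrite /c -fc0 dS.
  rewrite cb b0 orbT; apply/omap_block_cons; split=> //; apply/pathP.
  by split=> // j; rewrite -fcS dS inE.
rewrite big_ord_recl fc0 -/b -margP {1}Scons.
move: prodP; case: ok {pathP} => prodP.
  rewrite (eq_bigr (fun j => if j \in S' then p j else 1 - p j)) => [|j _].
    by rewrite -prodP mulrCA divff ?mulr1.
  by rewrite fcS inE.
by move/eqP: prodP; rewrite mulf_eq0 invr_eq0 (negPf b0) orbF => /eqP.
Qed.

End Path.

(** * Probabilities of the events involved *)

Section Fibers.
Variables (R : realType) (d : measure_display) (T : measurableType d).
Variables (P : probability T R) (I : eqType) (X : T -> I).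

Lemma measure_fibers (s : seq I) : uniq s ->
  (forall i, i \in s -> measurable [set t | X t = i]%classic) ->
  measurable [set t | X t \in s]%classic /\
  P [set t | X t \in s]%classic = (\sum_(i <- s) P [set t | X t = i]%classic)%E.
Proof.
elim: s => [_ _|i s IHs /= /andP[is_notin s_uniq] Xmeas].
  rewrite (_ : [set t | X t \in [::]]%classic = set0); last by apply/seteqP; split.
  by rewrite measure0 big_nil; split.
have [|smeas Ps] := IHs s_uniq.
  by move=> j js; apply: Xmeas; rewrite in_cons js orbT.
have imeas : measurable [set t | X t = i]%classic.
  by apply: Xmeas; rewrite in_cons eqxx.
have -> : [set t | X t \in i :: s]%classic =
    ([set t | X t = i] `|` [set t | X t \in s])%classic.
  apply/seteqP; split=> t /=; rewrite in_cons.
    by case/orP => [/eqP|]; [left|right].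
  by case=> [->|->]; rewrite ?eqxx ?orbT.
split; first exact: measurableU.
rewrite measureU //; first by rewrite big_cons -Ps.
by apply/seteqP; split=> t //= -[-> its]; rewrite its in is_notin.
Qed.

End Fibers.

Lemma pfaffian_process_law (R : realType) d (T : measurableType d)
    (P : probability T R) n (J : T -> {set 'I_n}) (K : 'M[R[i]]_(n.*2)) :
  pfaffian_process P J K ->
  pf_law (fun S => fine (P [set t | J t = S]%classic)) K.
Proof.
case=> Kskew Jmeas PJ; split=> // S; first exact: fine_ge0.
rewrite -PJ; congr _%:C.
rewrite sum_fine => [|U _]; last exact: fin_num_measure.
congr fine.
have [|_] := @measure_fibers R d T P _ J (enum [pred U : {set 'I_n} | S \subset U]) (enum_uniq _).
  by move=> U _; exact: Jmeas.
rewrite big_enum_cond /= => E.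
rewrite (eq_bigl (fun U : {set 'I_n} => S \subset U)) in E; last first.
  by move=> U; rewrite andbT.
rewrite -E; congr (P _); apply/seteqP; split=> t /=; by rewrite mem_enum.
Qed.

Lemma draw_event (R : realType) n d (W : measurableType d)
    (Q : probability W R) (draw : 'I_n -> R -> {RV Q >-> bool})
    (p : 'I_n -> R) (S : {set 'I_n}) :
  fresh_bernoulli draw -> (forall j, 0 <= p j <= 1) ->
  measurable [set w | forall j, draw j (p j) w = (j \in S)]%classic /\
  Q [set w | forall j, draw j (p j) w = (j \in S)]%classic =
    (\prod_j (if j \in S then p j else 1 - p j))%:E.
Proof.
move=> [bern indep] p01; split.
  rewrite (_ : [set _ | _]%classic =
    (\bigcap_(j in [set: 'I_n]) (draw j (p j) @^-1` [set j \in S]))%classic).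
    apply: fin_bigcap_measurable => // j _.
    by rewrite -[X in measurable X]setTI; apply: measurable_funP.
  by apply/seteqP; split=> w /= dw j; [move=> _|]; apply: dw.
have := indep p p01 (fun j => [set j \in S]%classic); rewrite /= => ->.
rewrite -prodEFin; apply: eq_bigr => j _.
rewrite -[LHS]/(distribution Q (draw j (p j)) [set j \in S]%classic) bern //.
rewrite bernoulli_probE // !diracE.
have mem_b (b c : bool) : (b \in [set c]%classic) = (b == c).
  by apply/idP/eqP => [/set_mem|->] //; apply/mem_set.
by rewrite !mem_b; case: (j \in S) => /=; rewrite ?mule1 ?mule0 ?adde0 ?add0e.
Qed.

Theorem mainTheorem1 (R : realType) (n : nat) (hn : (0 < n)%N)
    (K : 'M[R[i]]_(n.*2))
    (d : measure_display) (T : measurableType d) (P : probability T R)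
    (J : T -> {set 'I_n}) (hJ : pfaffian_process P J K)
    (d' : measure_display) (W : measurableType d') (Q : probability W R)
    (draw : 'I_n -> R -> {RV Q >-> bool}) (hdraw : fresh_bernoulli draw) :
  let output (w : W) : option {set 'I_n} :=
    pf_sampler K (fun j p => draw j p w) in
  {ae Q, forall w, output w <> None} /\
  (forall S : {set 'I_n},
     measurable [set w | output w = Some S]%classic /\
     Q [set w | output w = Some S]%classic = P [set t | J t = S]%classic).
Proof.
move=> output; set w := fun S => fine (P [set t | J t = S]%classic).
have wK : pf_law w K := pfaffian_process_law hJ.
have outputP S : measurable [set v | output v = Some S]%classic /\
    Q [set v | output v = Some S]%classic = (w S)%:E.
  have [p [ok [p01 pathP wS]]] := pf_sampler_path S wK.
  case: ok => [|] in pathP wS.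
    rewrite (_ : [set v | _]%classic =
      [set v | forall j, draw j (p j) v = (j \in S)]%classic); last first.
      by apply/seteqP; split=> v /= => [/pathP[]|dS] //; apply/pathP.
    by have [Emeas ->] := draw_event S hdraw p01; rewrite wS.
  rewrite (_ : [set v | _]%classic = set0); last first.
    by apply/seteqP; split=> v //= /pathP[].
  by rewrite measure0 wS.
split; last first.
  move=> S; have [Smeas ->] := outputP S; split=> //.
  by rewrite fineK // fin_num_measure //; case: hJ.
(* s lists the successful outputs; their probabilities add up to 1. *)
pose s := [seq Some U | U <- enum {set 'I_n}].
have [||smeas Qs] := @measure_fibers R _ W Q _ output s.
- by rewrite map_inj_uniq ?enum_uniq // => S S' [].
- by move=> _ /mapP[S _ ->]; case: (outputP S).
have Qs1 : Q [set v | output v \in s]%classic = 1%E.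
  rewrite Qs big_map big_enum /= (eq_bigr (fun S => (w S)%:E)) => [|S _].
    by rewrite sumEFin (pf_law_sum1 wK).
  by case: (outputP S).
exists (~` [set v | output v \in s])%classic; split.
- exact: measurableC.
- by rewrite probability_setC // Qs1 subee.
move=> v /= none; rewrite /setC /=.
by case: (output v) none => [S none|_]; [case: none | move=> /mapP[]].
Qed.
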